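(* Let $\mathsf{C}$ be a Markov category. The following hold for all objects and morphisms of the indicated types: (a) Symmetry: if $\psi:I\to X\otimes W\otimes Y$ displays $X\perp Y\,|\,W$, then the morphism $I\to Y\otimes W\otimes X$ obtained from $\psi$ by permuting the outputs displays $Y\perp X\,|\,W$. (b) Decomposition: if $\psi:I\to X_1\otimes X_2\otimes W\otimes Y$ displays $(X_1\otimes X_2)\perp Y\,|\,W$, then the marginal of $\psi$ on $X_1\otimes W\otimes Y$ displays $X_1\perp Y\,|\,W$. (c) Contraction: if $\psi:I\to X\otimes W\otimes Z\otimes Y$ displays $X\perp Y\,|\,(W\otimes Z)$ and the marginal of $\psi$ on $X\otimes W\otimes Z$ displays $X\perp Z\,|\,W$, then $\psi$ also displays $X\perp(Z\otimes Y)\,|\,W$. Moreover, if $\mathsf{C}$ has conditionals, then also: (d) Weak union: if $\psi:I\to X_1\otimes X_2\otimes W\otimes Y$ displays $(X_1\otimes X_2)\perp Y\,|\,W$, then it also displays $X_1\perp Y\,|\,(W\otimes X_2)$.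
   Context: A Markov category is a symmetric monoidal category $(\mathsf{C},\otimes,I)$ with symmetry $\mathsf{swap}_{X,Y}:X\otimes Y\to Y\otimes X$, in which every object $X$ is equipped with morphisms $\mathsf{copy}_X:X\to X\otimes X$ and $\mathsf{del}_X:X\to I$ forming a commutative comonoid (coassociative, counital, cocommutative), such that: (i) $\mathsf{del}_{X\otimes Y}$ is $\mathsf{del}_X\otimes\mathsf{del}_Y$ followed by $I\otimes I\cong I$; (ii) $\mathsf{copy}_{X\otimes Y}$ is $\mathsf{copy}_X\otimes\mathsf{copy}_Y$ followed by the canonical isomorphism $(X\otimes X)\otimes(Y\otimes Y)\cong(X\otimes Y)\otimes(X\otimes Y)$ swapping the two middle factors; (iii) $\mathsf{del}_Y\circ f=\mathsf{del}_X$ for every $f:X\to Y$. Associators and unitors are suppressed in formulas. Write $\mathsf{copy}^{(3)}_W:=(\mathsf{copy}_W\otimes\mathrm{id}_W)\circ\mathsf{copy}_W:W\to W\otimes W\otimes W$. The marginal of a morphism on some of its output factors is obtained by composing with $\mathsf{del}$ on all the other output factors. A morphism $\psi:I\to X\otimes W\otimes Y$ displays the conditional independence $X\perp Y\,|\,W$ if there are $f:W\to X$, $g:W\to Y$ and $\phi:I\to W$ such that $\psi=(f\otimes\mathrm{id}_W\otimes g)\circ\mathsf{copy}^{(3)}_W\circ\phi$. When the output factors of a morphism appear in a different order, the condition is applied after reordering the outputs by symmetry isomorphisms (e.g. in (d), to the order $X_1\otimes(W\otimes X_2)\otimes Y$). $\mathsf{C}$ has conditionals if for every $f:A\to X\otimes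 Y$ there is $f_{|X}:X\otimes A\to Y$ such that $f=(\mathrm{id}_X\otimes f_{|X})\circ(\mathsf{copy}_X\otimes\mathrm{id}_A)\circ(f_X\otimes\mathrm{id}_A)\circ\mathsf{copy}_A$, where $f_X:=(\mathrm{id}_X\otimes\mathsf{del}_Y)\circ f:A\to X$. *)

(* Defs.v *)
Set Implicit Arguments.
Unset Strict Implicit.
Unset Printing Implicit Defensive.

Declare Scope markov_scope.
Delimit Scope markov_scope with markov.
Open Scope markov_scope.

Record category := Category {
  obj :> Type;
  hom : obj -> obj -> Type;
  idm : forall X : obj, hom X X;
  comp : forall X Y Z : obj, hom Y Z -> hom X Y -> hom X Z;
  comp_idl : forall (X Y : obj) (f : hom X Y), comp (idm Y) f = f;
  comp_idr : forall (X Y : obj) (f : hom X Y), comp f (idm X) = f;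
  compA : forall (X Y Z T : obj) (h : hom Z T) (g : hom Y Z) (f : hom X Y),
    comp h (comp g f) = comp (comp h g) f
}.

Arguments hom {c} X Y.
Arguments idm {c} X.

Notation "g ∘ f" := (comp g f) (at level 40, left associativity) : markov_scope.

Record monoidal_category := MonoidalCategory {
  mon_cat :> category;
  munit : mon_cat;
  otens : mon_cat -> mon_cat -> mon_cat;
  htens : forall X X' Y Y' : mon_cat,
    hom X X' -> hom Y Y' -> hom (otens X Y) (otens X' Y');
  htens_id : forall X Y : mon_cat, htens (idm X) (idm Y) = idm (otens X Y);
  htens_comp : forall (X X' X'' Y Y' Y'' : mon_cat)
      (f' : hom X' X'') (f : hom X X') (g' : hom Y' Y'') (g : hom Y Y'),
    htens (f' ∘ f) (g' ∘ g) = htens f' g' ∘ htens f g;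
  assoc : forall X Y Z : mon_cat,
    hom (otens (otens X Y) Z) (otens X (otens Y Z));
  assoc_inv : forall X Y Z : mon_cat,
    hom (otens X (otens Y Z)) (otens (otens X Y) Z);
  assocK : forall X Y Z : mon_cat, assoc_inv X Y Z ∘ assoc X Y Z = idm _;
  assoc_invK : forall X Y Z : mon_cat, assoc X Y Z ∘ assoc_inv X Y Z = idm _;
  assoc_nat : forall (X X' Y Y' Z Z' : mon_cat)
      (f : hom X X') (g : hom Y Y') (h : hom Z Z'),
    assoc X' Y' Z' ∘ htens (htens f g) h =
    htens f (htens g h) ∘ assoc X Y Z;
  lunit : forall X : mon_cat, hom (otens munit X) X;
  lunit_inv : forall X : mon_cat, hom X (otens munit X);
  lunitK : forall X : mon_cat, lunit_inv X ∘ lunit X = idm _;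
  lunit_invK : forall X : mon_cat, lunit X ∘ lunit_inv X = idm _;
  lunit_nat : forall (X Y : mon_cat) (f : hom X Y),
    lunit Y ∘ htens (idm munit) f = f ∘ lunit X;
  runit : forall X : mon_cat, hom (otens X munit) X;
  runit_inv : forall X : mon_cat, hom X (otens X munit);
  runitK : forall X : mon_cat, runit_inv X ∘ runit X = idm _;
  runit_invK : forall X : mon_cat, runit X ∘ runit_inv X = idm _;
  runit_nat : forall (X Y : mon_cat) (f : hom X Y),
    runit Y ∘ htens f (idm munit) = f ∘ runit X;
  triangle : forall X Y : mon_cat,
    htens (idm X) (lunit Y) ∘ assoc X munit Y = htens (runit X) (idm Y);
  pentagon : forall X Y Z T : mon_cat,
    assoc X Y (otens Z T) ∘ assoc (otens X Y) Z T =
    htens (idm X) (assoc Y Z T) ∘ assoc X (otens Y Z) T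
      ∘ htens (assoc X Y Z) (idm T)
}.

Arguments munit {m}.
Arguments assoc {m} X Y Z.
Arguments assoc_inv {m} X Y Z.
Arguments lunit {m} X.
Arguments lunit_inv {m} X.
Arguments runit {m} X.
Arguments runit_inv {m} X.

(* Left associative, so that X ⊗ W ⊗ Y is (X ⊗ W) ⊗ Y. *)
Notation "X ⊗ Y" := (otens X Y) (at level 39, left associativity) : markov_scope.
Notation "f ⊗₁ g" := (htens f g) (at level 39, left associativity) : markov_scope.

Record symmetric_monoidal_category := SymmetricMonoidalCategory {
  sym_mon :> monoidal_category;
  swap : forall X Y : sym_mon, hom (X ⊗ Y) (Y ⊗ X);
  swap_nat : forall (X X' Y Y' : sym_mon) (f : hom X X') (g : hom Y Y'),
    swap X' Y' ∘ (f ⊗₁ g) = (g ⊗₁ f) ∘ swap X Y;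
  swapK : forall X Y : sym_mon, swap Y X ∘ swap X Y = idm (X ⊗ Y);
  hexagon : forall X Y Z : sym_mon,
    assoc Y Z X ∘ swap X (Y ⊗ Z) ∘ assoc X Y Z =
    (idm Y ⊗₁ swap X Z) ∘ assoc Y X Z ∘ (swap X Y ⊗₁ idm Z)
}.

Arguments swap {s} X Y.

Definition middle_swap (C : symmetric_monoidal_category) (X X' Y Y' : C) :
    hom ((X ⊗ X') ⊗ (Y ⊗ Y')) ((X ⊗ Y) ⊗ (X' ⊗ Y')) :=
  assoc_inv X Y (X' ⊗ Y')
    ∘ (idm X ⊗₁ (assoc Y X' Y' ∘ (swap X' Y ⊗₁ idm Y') ∘ assoc_inv X' Y Y'))
    ∘ assoc X X' (Y ⊗ Y').

Record markov_category := MarkovCategory {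
  markov_sym :> symmetric_monoidal_category;
  copy : forall X : markov_sym, hom X (X ⊗ X);
  del : forall X : markov_sym, hom X munit;
  copyA : forall X : markov_sym,
    assoc X X X ∘ (copy X ⊗₁ idm X) ∘ copy X = (idm X ⊗₁ copy X) ∘ copy X;
  copy_del_l : forall X : markov_sym,
    lunit X ∘ (del X ⊗₁ idm X) ∘ copy X = idm X;
  copy_del_r : forall X : markov_sym,
    runit X ∘ (idm X ⊗₁ del X) ∘ copy X = idm X;
  copyC : forall X : markov_sym, swap X X ∘ copy X = copy X;
  del_tens : forall X Y : markov_sym,
    del (X ⊗ Y) = lunit munit ∘ (del X ⊗₁ del Y);
  copy_tens : forall X Y : markov_sym,
    copy (X ⊗ Y) = middle_swap X X Y Y ∘ (copy X ⊗₁ copy Y);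
  del_nat : forall (X Y : markov_sym) (f : hom X Y), del Y ∘ f = del X
}.

Arguments copy {m} X.
Arguments del {m} X.

Section MarkovDefinitions.

Variable C : markov_category.

Definition copy3 (W : C) : hom W (W ⊗ W ⊗ W) := (copy W ⊗₁ idm W) ∘ copy W.

Definition proj_l (X Y : C) : hom (X ⊗ Y) X := runit X ∘ (idm X ⊗₁ del Y).

(* With left-nested tensors, copy3 W lands in exactly the bracketing needed
   here, so no associator appears. *)
Definition displays_ci (X W Y : C) (psi : hom munit (X ⊗ W ⊗ Y)) : Prop :=
  exists (f : hom W X) (g : hom W Y) (phi : hom munit W),
    psi = (f ⊗₁ idm W ⊗₁ g) ∘ copy3 W ∘ phi.

Definition has_conditionals : Prop :=
  forall (A X Y : C) (f : hom A (X ⊗ Y)),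
  exists f_X : hom (X ⊗ A) Y,
    f = (idm X ⊗₁ f_X) ∘ assoc X X A ∘ (copy X ⊗₁ idm A)
          ∘ ((proj_l X Y ∘ f) ⊗₁ idm A) ∘ copy A.

Definition reverse3 (X W Y : C) : hom (X ⊗ W ⊗ Y) (Y ⊗ W ⊗ X) :=
  assoc_inv Y W X ∘ (idm Y ⊗₁ swap X W) ∘ swap (X ⊗ W) Y.

End MarkovDefinitions.

Arguments copy3 {C} W.
Arguments proj_l {C} X Y.
Arguments displays_ci {C} X W Y psi.
Arguments reverse3 {C} X W Y.

(* Main.v *)
(** Write [⟨f, g⟩] for [(f ⊗ g) ∘ copy].  Structural isomorphisms and
    projections act on these pairings as on tuples in a cartesian category; the
    only cartesian law that fails is [⟨f, g⟩ ∘ h = ⟨f ∘ h, g ∘ h⟩], which needs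
    [h] to commute with [copy].  A substitute that needs no determinism is
    [⟨proj_l, h⟩ ∘ ⟨1, g⟩ = ⟨1, h ∘ ⟨1, g⟩⟩], and its mirror image.  Since
    [displays_ci] says [psi = ⟨⟨f, 1⟩, g⟩ ∘ phi], parts (a) and (b) are immediate.
    For (c), the second hypothesis rewrites [⟨f, 1⟩ ∘ phi] as
    [⟨f', ⟨1, g'⟩⟩ ∘ phi'], and the substitute pulls [W] out of
    [⟨1, g⟩ ∘ ⟨1, g'⟩].  For (d), conditioning [f : W -> X1 ⊗ X2] on [X2] gives
    [f = ⟨c, proj_l⟩ ∘ ⟨h, 1⟩] with [h : W -> X2], and the mirrored substitute
    pulls [⟨h, 1⟩] out of the whole pairing. *)

From Corelib Require Import ssreflect.
Require Import Defs.

Set Implicit Arguments.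
Unset Strict Implicit.
Unset Printing Implicit Defensive.

(** * Coherence: unitors, and naturality of the middle swap *)

Lemma comp_cancel (C : category) (X Y Z : C) (e : hom X Y) (e' : hom Y X)
    (f g : hom Y Z) :
  e ∘ e' = idm Y -> f ∘ e = g ∘ e -> f = g.
Proof. by move=> ee' fg; rewrite -(comp_idr f) -(comp_idr g) -ee' !compA fg. Qed.

Section Monoidal.

Variable C : monoidal_category.
Implicit Types X Y Z : C.

Lemma munit_tens_inj X Y (f g : hom X Y) :
  idm munit ⊗₁ f = idm munit ⊗₁ g -> f = g.
Proof.
move=> fg; apply: (comp_cancel (lunit_invK X)).
by rewrite -!lunit_nat fg.
Qed.

Lemma tens_munit_inj X Y (f g : hom X Y) :
  f ⊗₁ idm munit = g ⊗₁ idm munit -> f = g.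
Proof.
move=> fg; apply: (comp_cancel (runit_invK X)).
by rewrite -!runit_nat fg.
Qed.

(** Kelly's argument: after tensoring with [munit] on the left and precomposing with two associator
    isomorphisms, both sides reduce to each other by the pentagon, the triangle and naturality of
    [assoc]. *)
Lemma lunit_assoc X Y :
  lunit (X ⊗ Y) ∘ assoc munit X Y = lunit X ⊗₁ idm Y.
Proof.
apply: munit_tens_inj.
apply: (comp_cancel (assoc_invK munit (munit ⊗ X) Y)).
apply: (@comp_cancel _ _ _ _ (assoc munit munit X ⊗₁ idm Y)
                      (assoc_inv munit munit X ⊗₁ idm Y)).
  by rewrite -htens_comp assoc_invK comp_idl htens_id.
rewrite -{1}(comp_idl (idm munit)) htens_comp -!compA.
rewrite [_ ∘ (assoc _ (munit ⊗ X) Y ∘ _)]compA -pentagon compA triangle.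
rewrite -htens_id -assoc_nat -triangle.
rewrite compA -assoc_nat -compA -htens_comp.
by rewrite comp_idl.
Qed.

Lemma lunit_runit : lunit munit = runit munit :> hom (munit ⊗ munit : C) munit.
Proof.
apply: tens_munit_inj.
rewrite -lunit_assoc -triangle; congr (_ ∘ _).
(* What remains is [lunit (munit ⊗ munit) = idm munit ⊗₁ lunit munit], which is naturality of
   [lunit] at [lunit munit] once the isomorphism [lunit munit] is cancelled. *)
by rewrite -[LHS]comp_idl -[RHS]comp_idl -lunitK -!compA lunit_nat.
Qed.

End Monoidal.

Lemma middle_swap_nat (C : symmetric_monoidal_category)
    (X X' Y Y' Z Z' T T' : C)
    (a : hom X Z) (b : hom X' Z') (c : hom Y T) (d : hom Y' T') :
  middle_swap Z Z' T T' ∘ ((a ⊗₁ b) ⊗₁ (c ⊗₁ d)) =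
  ((a ⊗₁ c) ⊗₁ (b ⊗₁ d)) ∘ middle_swap X X' Y Y'.
Proof.
have assoc_inv_nat (A A' B B' D D' : C) (f : hom A A') (g : hom B B')
    (h : hom D D') :
    assoc_inv A' B' D' ∘ (f ⊗₁ (g ⊗₁ h)) = (f ⊗₁ g) ⊗₁ h ∘ assoc_inv A B D.
  apply: (comp_cancel (assoc_invK A B D)).
  by rewrite -!compA -assoc_nat assocK comp_idr compA assocK comp_idl.
have inner : assoc T Z' T' ∘ (swap Z' T ⊗₁ idm T') ∘ assoc_inv Z' T T' ∘
    (b ⊗₁ (c ⊗₁ d)) = (c ⊗₁ (b ⊗₁ d)) ∘
    (assoc Y X' Y' ∘ (swap X' Y ⊗₁ idm Y') ∘ assoc_inv X' Y Y').
  rewrite -compA assoc_inv_nat !compA -assoc_nat; congr (_ ∘ _).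
  rewrite -!compA -!htens_comp; congr (_ ∘ _).
  by rewrite swap_nat comp_idl comp_idr.
rewrite /middle_swap -compA assoc_nat !compA -assoc_inv_nat; congr (_ ∘ _).
rewrite -!compA -!htens_comp; congr (_ ∘ _).
by rewrite comp_idl comp_idr !compA inner !compA.
Qed.

(** * Terminality of the unit object *)

Section Markov.

Variable C : markov_category.
Implicit Types A X Y Z W : C.

(** By [del_nat], [del munit] is idempotent; by counitality it has a right inverse. An idempotent
    with a right inverse is the identity. *)
Lemma del_munit : del munit = idm munit :> hom (munit : C) munit.
Proof.
have del_epi : del munit ∘ (lunit munit ∘ copy munit) = idm (munit : C).
  by rewrite compA {1}lunit_runit -runit_nat -lunit_runit copy_del_l.
by rewrite -[LHS]comp_idr -del_epi compA del_nat.
Qed.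

Lemma munit_terminal A (f g : hom A munit) : f = g.
Proof. by rewrite -(comp_idl f) -(comp_idl g) -del_munit !del_nat. Qed.

Lemma munit2_terminal A (f g : hom A (munit ⊗ munit)) : f = g.
Proof.
rewrite -(comp_idl f) -(comp_idl g) -lunitK -!compA; congr (_ ∘ _).
exact: munit_terminal.
Qed.

(** * Calculus of pairings *)

Definition pairing A X Y (f : hom A X) (g : hom A Y) : hom A (X ⊗ Y) :=
  (f ⊗₁ g) ∘ copy A.

Notation "⟨ f , g ⟩" := (pairing f g) : markov_scope.

Definition proj_r X Y : hom (X ⊗ Y) Y := lunit Y ∘ (del X ⊗₁ idm Y).

Definition deterministic X Y (f : hom X Y) := copy Y ∘ f = ⟨f, f⟩.

Lemma tens_pairing A X X' Y Y' (f : hom X X') (g : hom Y Y') (h : hom A X)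
    (k : hom A Y) :
  (f ⊗₁ g) ∘ ⟨h, k⟩ = ⟨f ∘ h, g ∘ k⟩.
Proof. by rewrite /pairing htens_comp !compA. Qed.

Lemma pairing_id X : ⟨idm X, idm X⟩ = copy X.
Proof. by rewrite /pairing htens_id comp_idl. Qed.

Lemma assoc_pairing A X Y Z (f : hom A X) (g : hom A Y) (h : hom A Z) :
  assoc X Y Z ∘ ⟨⟨f, g⟩, h⟩ = ⟨f, ⟨g, h⟩⟩.
Proof.
rewrite /pairing -{1}(comp_idr h) htens_comp !compA assoc_nat -!compA.
rewrite [assoc _ _ _ ∘ _]compA copyA.
by rewrite !compA -htens_comp comp_idr.
Qed.

Lemma assoc_inv_pairing A X Y Z (f : hom A X) (g : hom A Y) (h : hom A Z) :
  assoc_inv X Y Z ∘ ⟨f, ⟨g, h⟩⟩ = ⟨⟨f, g⟩, h⟩.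
Proof. by rewrite -assoc_pairing compA assocK comp_idl. Qed.

Lemma swap_pairing A X Y (f : hom A X) (g : hom A Y) :
  swap X Y ∘ ⟨f, g⟩ = ⟨g, f⟩.
Proof. by rewrite /pairing compA swap_nat -compA copyC. Qed.

Lemma proj_l_pairing A X Y (f : hom A X) (g : hom A Y) :
  proj_l X Y ∘ ⟨f, g⟩ = f.
Proof.
rewrite /proj_l -compA tens_pairing comp_idl del_nat.
rewrite /pairing -{1}(comp_idr f) -(comp_idl (del A)) htens_comp.
by rewrite !compA runit_nat -!compA [runit A ∘ _]compA copy_del_r comp_idr.
Qed.

Lemma proj_r_pairing A X Y (f : hom A X) (g : hom A Y) :
  proj_r X Y ∘ ⟨f, g⟩ = g.
Proof.
rewrite /proj_r -compA tens_pairing comp_idl del_nat.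
rewrite /pairing -{1}(comp_idr g) -(comp_idl (del A)) htens_comp.
by rewrite !compA lunit_nat -!compA [lunit A ∘ _]compA copy_del_l comp_idr.
Qed.

Lemma middle_swap_pairing A X X' Y Y' (f : hom A X) (f' : hom A X')
    (g : hom A Y) (g' : hom A Y') :
  middle_swap X X' Y Y' ∘ ⟨⟨f, f'⟩, ⟨g, g'⟩⟩ = ⟨⟨f, g⟩, ⟨f', g'⟩⟩.
Proof.
rewrite /middle_swap -!compA assoc_pairing tens_pairing comp_idl -!compA.
rewrite assoc_inv_pairing tens_pairing swap_pairing comp_idl assoc_pairing.
by rewrite assoc_inv_pairing.
Qed.

Lemma pairing_proj X Y : ⟨proj_l X Y, proj_r X Y⟩ = idm (X ⊗ Y).
Proof.
rewrite /pairing /proj_l /proj_r copy_tens htens_comp compA.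
rewrite -[_ ∘ middle_swap _ _ _ _]compA -middle_swap_nat.
(* Once the deletions have moved past the middle swap, it only exchanges two copies of [munit], and
   this is the identity by terminality. *)
have -> : middle_swap X munit munit Y = idm _.
  rewrite /middle_swap (munit2_terminal (swap munit munit) (idm _)) htens_id.
  by rewrite comp_idr assoc_invK htens_id comp_idr assocK.
by rewrite comp_idl -!htens_comp copy_del_r copy_del_l htens_id.
Qed.

(** * Deterministic morphisms *)

Lemma pairing_comp A B X Y (f : hom B X) (g : hom B Y) (d : hom A B) :
  deterministic d -> ⟨f, g⟩ ∘ d = ⟨f ∘ d, g ∘ d⟩.
Proof. by rewrite /pairing => dP; rewrite -compA dP tens_pairing. Qed.

Lemma deterministic_comp X Y Z (f : hom Y Z) (g : hom X Y) :
  deterministic f -> deterministic g -> deterministic (f ∘ g).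
Proof. by move=> fP gP; rewrite /deterministic compA fP pairing_comp. Qed.

Lemma deterministic_id X : deterministic (idm X).
Proof. by rewrite /deterministic comp_idr pairing_id. Qed.

Lemma deterministic_del X : deterministic (del X).
Proof. exact: munit2_terminal. Qed.

Lemma deterministic_pairing A X Y (f : hom A X) (g : hom A Y) :
  deterministic f -> deterministic g -> deterministic ⟨f, g⟩.
Proof.
move=> fP gP; rewrite /deterministic copy_tens -compA tens_pairing fP gP.
exact: middle_swap_pairing.
Qed.

Lemma deterministic_tens X X' Y Y' (f : hom X X') (g : hom Y Y') :
  deterministic f -> deterministic g -> deterministic (f ⊗₁ g).
Proof.
move=> fP gP; rewrite /deterministic /pairing !copy_tens -compA -htens_comp.
by rewrite fP gP /pairing htens_comp compA middle_swap_nat -compA.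
Qed.

Lemma deterministic_inv X Y (f : hom X Y) (g : hom Y X) :
  f ∘ g = idm Y -> g ∘ f = idm X -> deterministic g -> deterministic f.
Proof.
move=> fg gf gP; rewrite /deterministic -{1}(comp_idl (copy Y)) -htens_id -fg.
rewrite htens_comp -!compA [(g ⊗₁ g) ∘ _]compA -[(g ⊗₁ g) ∘ _]gP.
by rewrite -compA gf comp_idr.
Qed.

(* Determinism of the unitors needs no further coherence, because their inverses
   are the pairings [⟨idm, del⟩] and [⟨del, idm⟩]. *)
Lemma deterministic_proj_l X Y : deterministic (proj_l X Y).
Proof.
apply: deterministic_comp; last first.
  by apply: deterministic_tens; [apply: deterministic_id | apply: deterministic_del].
apply: (deterministic_inv (runit_invK X) (runitK X)).
have -> : runit_inv X = ⟨idm X, del X⟩.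
  by rewrite -[RHS]comp_idl -runitK -compA [runit X ∘ _]compA copy_del_r comp_idr.
by apply: deterministic_pairing; [apply: deterministic_id | apply: deterministic_del].
Qed.

Lemma deterministic_proj_r X Y : deterministic (proj_r X Y).
Proof.
apply: deterministic_comp; last first.
  by apply: deterministic_tens; [apply: deterministic_del | apply: deterministic_id].
apply: (deterministic_inv (lunit_invK Y) (lunitK Y)).
have -> : lunit_inv Y = ⟨del Y, idm Y⟩.
  by rewrite -[RHS]comp_idl -lunitK -compA [lunit Y ∘ _]compA copy_del_l comp_idr.
by apply: deterministic_pairing; [apply: deterministic_del | apply: deterministic_id].
Qed.

Lemma swapE X Y : swap X Y = ⟨proj_r X Y, proj_l X Y⟩.
Proof. by rewrite -[LHS]comp_idr -pairing_proj swap_pairing. Qed.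

Lemma deterministic_swap X Y : deterministic (swap X Y).
Proof.
rewrite swapE; apply: deterministic_pairing.
  exact: deterministic_proj_r.
exact: deterministic_proj_l.
Qed.

(** * Composing pairings when only one component is deterministic *)

Lemma assoc_copy_tens X Y :
  assoc X X Y ∘ (copy X ⊗₁ idm Y) = ⟨proj_l X Y, idm (X ⊗ Y)⟩.
Proof.
rewrite -[LHS]comp_idr -{1}pairing_proj -compA tens_pairing comp_idl.
by rewrite deterministic_proj_l assoc_pairing pairing_proj.
Qed.

(** Only the wire carrying [f] gets copied, while [g] and [h] each occur once on both sides; hence
    determinism of [f] alone suffices. *)
Lemma pairing_proj_l_comp A X Y Z (f : hom A X) (g : hom A Y)
    (h : hom (X ⊗ Y) Z) :
  deterministic f -> ⟨proj_l X Y, h⟩ ∘ ⟨f, g⟩ = ⟨f, h ∘ ⟨f, g⟩⟩.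
Proof.
move=> fP.
have -> : ⟨proj_l X Y, h⟩ = (idm X ⊗₁ h) ∘ (assoc X X Y ∘ (copy X ⊗₁ idm Y)).
  by rewrite assoc_copy_tens tens_pairing comp_idl comp_idr.
rewrite -!compA tens_pairing fP comp_idl assoc_pairing tens_pairing.
by rewrite comp_idl.
Qed.

Lemma pairing_proj_r_comp A X Y Z (f : hom A X) (g : hom A Y)
    (h : hom (X ⊗ Y) Z) :
  deterministic g -> ⟨h, proj_r X Y⟩ ∘ ⟨f, g⟩ = ⟨h ∘ ⟨f, g⟩, g⟩.
Proof.
move=> gP; rewrite -(swap_pairing g f) compA.
rewrite (pairing_comp _ _ (deterministic_swap Y X)).
rewrite -swap_pairing (swapE Y X) proj_r_pairing -compA pairing_proj_l_comp //.
by rewrite swap_pairing compA.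
Qed.

(** * Properties of conditional independence *)

Lemma displays_ciE X W Y (psi : hom munit (X ⊗ W ⊗ Y)) :
  displays_ci X W Y psi <->
  exists (f : hom W X) (g : hom W Y) (phi : hom munit W),
    psi = ⟨⟨f, idm W⟩, g⟩ ∘ phi.
Proof.
have E (f : hom W X) (g : hom W Y) :
    (f ⊗₁ idm W ⊗₁ g) ∘ copy3 W = ⟨⟨f, idm W⟩, g⟩.
  by rewrite /copy3 compA -htens_comp comp_idr.
by split=> -[f [g [phi ->]]]; exists f, g, phi; rewrite E.
Qed.

Lemma displays_ci_symmetry X W Y (psi : hom munit (X ⊗ W ⊗ Y)) :
  displays_ci X W Y psi -> displays_ci Y W X (reverse3 X W Y ∘ psi).
Proof.
move=> /displays_ciE [f [g [phi ->]]]; apply/displays_ciE; exists g, f, phi.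
rewrite compA; congr (_ ∘ _); rewrite /reverse3 -!compA swap_pairing.
by rewrite tens_pairing swap_pairing comp_idl assoc_inv_pairing.
Qed.

Lemma displays_ci_decomposition X1 X2 W Y (psi : hom munit (X1 ⊗ X2 ⊗ W ⊗ Y)) :
  displays_ci (X1 ⊗ X2) W Y psi ->
  displays_ci X1 W Y ((proj_l X1 X2 ⊗₁ idm W ⊗₁ idm Y) ∘ psi).
Proof.
move=> /displays_ciE [f [g [phi ->]]]; apply/displays_ciE.
exists (proj_l X1 X2 ∘ f), g, phi.
by rewrite compA !tens_pairing !comp_idl.
Qed.

Lemma displays_ci_contraction X W Z Y (psi : hom munit (X ⊗ W ⊗ Z ⊗ Y)) :
  displays_ci X (W ⊗ Z) Y ((assoc X W Z ⊗₁ idm Y) ∘ psi) ->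
  displays_ci X W Z (proj_l (X ⊗ W ⊗ Z) Y ∘ psi) ->
  displays_ci X W (Z ⊗ Y) (assoc (X ⊗ W) Z Y ∘ psi).
Proof.
move=> /displays_ciE [f [g [phi psiE]]] /displays_ciE [f' [g' [phi' margE]]].
(* Fully right-bracketed, [psi] is its own marginal on [X], [W], [Z] followed by a map that keeps
   these outputs and generates [Y] by [g]. *)
have psiE' : assoc X W (Z ⊗ Y) ∘ (assoc (X ⊗ W) Z Y ∘ psi) =
    (idm X ⊗₁ ⟨proj_l W Z, ⟨proj_r W Z, g⟩⟩) ∘ (⟨f, idm (W ⊗ Z)⟩ ∘ phi).
  rewrite compA pentagon -!compA psiE [assoc X (W ⊗ Z) Y ∘ _]compA.
  rewrite assoc_pairing ![_ ∘ (_ ∘ phi)]compA !tens_pairing !comp_idl comp_idr.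
  by rewrite -{1}pairing_proj assoc_pairing.
(* That marginal, computed from each of the two hypotheses. *)
have margE' : ⟨f, idm (W ⊗ Z)⟩ ∘ phi = ⟨f', ⟨idm W, g'⟩⟩ ∘ phi'.
  have projE : proj_l (X ⊗ (W ⊗ Z)) Y ∘ (assoc X W Z ⊗₁ idm Y) =
      assoc X W Z ∘ proj_l (X ⊗ W ⊗ Z) Y.
    rewrite /proj_l -compA -htens_comp comp_idl comp_idr compA -runit_nat.
    by rewrite -compA -htens_comp comp_idl comp_idr.
  rewrite -(proj_l_pairing ⟨f, idm (W ⊗ Z)⟩ g) -compA -psiE compA projE.
  by rewrite -compA margE compA assoc_pairing.
(* The second witness generates [Z] from [W] by [g'], then keeps it while generating [Y] from both
   by [g]. *)
apply/displays_ciE; exists f', (⟨proj_r W Z, g⟩ ∘ ⟨idm W, g'⟩), phi'.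
rewrite -[LHS]comp_idl -assocK -compA psiE' margE'.
rewrite [(_ ⊗₁ _) ∘ _]compA tens_pairing comp_idl.
rewrite (pairing_proj_l_comp _ _ (deterministic_id W)).
by rewrite compA assoc_inv_pairing.
Qed.

Lemma displays_ci_weak_union X1 X2 W Y (psi : hom munit (X1 ⊗ X2 ⊗ W ⊗ Y)) :
  has_conditionals C -> displays_ci (X1 ⊗ X2) W Y psi ->
  displays_ci X1 (W ⊗ X2) Y
    ((((idm X1 ⊗₁ swap X2 W) ∘ assoc X1 X2 W) ⊗₁ idm Y) ∘ psi).
Proof.
move=> cond /displays_ciE [f [g [phi ->]]]; apply/displays_ciE.
(* [has_conditionals] conditions on the left factor, so [X2] is swapped to the front; [c] then
   generates [X1] from [X2 ⊗ W]. *)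
have [c] := cond _ _ _ (swap X1 X2 ∘ f).
set h := proj_l X2 X1 ∘ _ => fE.
have {fE} -> : f = ⟨c, proj_l X2 W⟩ ∘ ⟨h, idm W⟩.
  have stepE : ⟨proj_l X2 W, c⟩ =
      (idm X2 ⊗₁ c) ∘ (assoc X2 X2 W ∘ (copy X2 ⊗₁ idm W)).
    by rewrite assoc_copy_tens tens_pairing comp_idl comp_idr.
  rewrite -(swap_pairing (proj_l X2 W)) stepE -(comp_idl f) -swapK -compA fE.
  by rewrite /pairing !compA.
(* The last two components depend on [W] alone, so they factor through [proj_r X2 W]; the mirrored
   law then applies with the deterministic component [idm W]. *)
have hE : ⟨⟨⟨c, proj_l X2 W⟩ ∘ ⟨h, idm W⟩, idm W⟩, g⟩ =
    ⟨⟨⟨c, proj_l X2 W⟩, proj_r X2 W⟩, g ∘ proj_r X2 W⟩ ∘ ⟨h, idm W⟩.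
  have graphE : ⟨proj_r X2 W, g ∘ proj_r X2 W⟩ = ⟨idm W, g⟩ ∘ proj_r X2 W.
    by rewrite pairing_comp ?comp_idl //; apply: deterministic_proj_r.
  rewrite -(assoc_inv_pairing (_ ∘ _)) -(assoc_inv_pairing ⟨c, _⟩) graphE.
  rewrite -[RHS]compA; congr (_ ∘ _).
  have -> : ⟨⟨c, proj_l X2 W⟩, ⟨idm W, g⟩ ∘ proj_r X2 W⟩ =
      (idm (X1 ⊗ X2) ⊗₁ ⟨idm W, g⟩) ∘ ⟨⟨c, proj_l X2 W⟩, proj_r X2 W⟩.
    by rewrite tens_pairing comp_idl.
  rewrite -[RHS]compA.
  rewrite (pairing_proj_r_comp _ _ (deterministic_id W)).
  by rewrite tens_pairing comp_idl comp_idr.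
have swapP := @deterministic_swap W X2.
(* The new conditioning state on [W ⊗ X2] is [phi] extended by [h]. The swaps are there because [c]
   reads its inputs in the order [X2 ⊗ W]; the witness for [Y] discards [X2]. *)
exists (c ∘ swap W X2), (g ∘ proj_r X2 W ∘ swap W X2), (⟨idm W, h⟩ ∘ phi).
rewrite hE -(swap_pairing (idm W) h) ![_ ∘ (_ ∘ phi)]compA; congr (_ ∘ _).
rewrite ![_ ∘ (_ ∘ ⟨idm W, h⟩)]compA; congr (_ ∘ _).
rewrite [LHS]compA tens_pairing comp_idl -[_ ∘ ⟨_, proj_r X2 W⟩]compA.
rewrite assoc_pairing tens_pairing swap_pairing comp_idl.
by rewrite -swapE 2!(pairing_comp _ _ swapP) swapK.
Qed.

End Markov.

Theorem lemma12p5 (C : markov_category) :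
  (* (a) symmetry *)
  (forall (X W Y : C) (psi : hom munit (X ⊗ W ⊗ Y)),
     displays_ci X W Y psi ->
     displays_ci Y W X (reverse3 X W Y ∘ psi)) /\
  (* (b) decomposition *)
  (forall (X1 X2 W Y : C) (psi : hom munit (X1 ⊗ X2 ⊗ W ⊗ Y)),
     displays_ci (X1 ⊗ X2) W Y psi ->
     displays_ci X1 W Y ((proj_l X1 X2 ⊗₁ idm W ⊗₁ idm Y) ∘ psi)) /\
  (* (c) contraction *)
  (forall (X W Z Y : C) (psi : hom munit (X ⊗ W ⊗ Z ⊗ Y)),
     displays_ci X (W ⊗ Z) Y ((assoc X W Z ⊗₁ idm Y) ∘ psi) ->
     displays_ci X W Z (proj_l (X ⊗ W ⊗ Z) Y ∘ psi) ->
     displays_ci X W (Z ⊗ Y) (assoc (X ⊗ W) Z Y ∘ psi)) /\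
  (* (d) weak union *)
  (has_conditionals C ->
   forall (X1 X2 W Y : C) (psi : hom munit (X1 ⊗ X2 ⊗ W ⊗ Y)),
     displays_ci (X1 ⊗ X2) W Y psi ->
     displays_ci X1 (W ⊗ X2) Y
       ((((idm X1 ⊗₁ swap X2 W) ∘ assoc X1 X2 W) ⊗₁ idm Y) ∘ psi)).
Proof.
split; first exact: displays_ci_symmetry.
split; first exact: displays_ci_decomposition.
split; first exact: displays_ci_contraction.
by move=> cond X1 X2 W Y psi; apply: displays_ci_weak_union.
Qed.
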